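(* Let $S,W$ be random variables on $\mathcal S\times\mathcal W$ with joint law $P_{SW}$ and marginals $P_S,P_W$, and assume $P_{SW}\ll P_SP_W$; write $L:=\frac{\mathrm dP_{SW}}{\mathrm d(P_SP_W)}$. Let $E\subseteq\mathcal S\times\mathcal W$ be measurable, and for $w\in\mathcal W$ let $E_w:=\{s:(s,w)\in E\}$. Let $\psi,\varphi$ be Orlicz functions. Then for every $\gamma\in\mathbb R$, $$P_{SW}(E)\le \gamma\,(P_SP_W)(E)+\Big\Vert\, w\mapsto\big\Vert\mathds 1_{E_w}\big\Vert^{P_S}_{\varphi}\Big\Vert^{P_W}_{\psi}\cdot\Big\Vert\, w\mapsto\big\Vert [L(\cdot,w)-\gamma]_+\big\Vert^{A,P_S}_{\varphi^\star}\Big\Vert^{A,P_W}_{\psi^\star}.$$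
   Context: An Orlicz function is a convex $\psi:[0,\infty)\to[0,\infty]$ with $\psi(0)=0$ that is not identically $0$ or identically $\infty$ on $(0,\infty)$; its conjugate is $\psi^\star(t):=\sup_{\lambda>0}(\lambda t-\psi(\lambda))$. For a probability measure $\mu$ and measurable $U$, the Luxemburg norm is $\Vert U\Vert^\mu_\psi:=\inf\{\sigma>0:\mathbf E_\mu[\psi(|U|/\sigma)]\le1\}$ and the Amemiya norm is $\Vert U\Vert^{A,\mu}_\psi:=\inf\{(\mathbf E_\mu[\psi(t|U|)]+1)/t:\ t>0\}$. $[x]_+:=\max\{x,0\}$. *)

(* Defs.v *)
From HB Require Import structures.
From mathcomp Require Import all_boot all_order all_algebra.
From mathcomp Require Import all_classical all_reals all_analysis.
Set Implicit Arguments. Unset Strict Implicit. Unset Printing Implicit Defensive.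
Import Order.TTheory GRing.Theory Num.Theory.
Local Open Scope classical_set_scope.
Local Open Scope ring_scope.
Local Open Scope ereal_scope.

Section orlicz.
Context {R : realType}.

(* An Orlicz function psi : [0,oo) -> [0,oo]; only its values on [0,oo) matter. *)
Definition is_orlicz (psi : R -> \bar R) : Prop :=
  [/\ psi 0%R = 0,
      (forall x : R, (0 <= x)%R -> 0 <= psi x),
      (forall x y t : R, (0 <= x)%R -> (0 <= y)%R -> (0 <= t <= 1)%R ->
          psi (t * x + (1 - t) * y)%R <= t%:E * psi x + (1 - t)%:E * psi y),
      (exists x : R, (0 < x)%R /\ psi x != 0) &
      (exists x : R, (0 < x)%R /\ psi x != +oo)].

Definition orlicz_conj (psi : R -> \bar R) (t : R) : \bar R :=
  ereal_sup [set (l * t)%:E - psi l | l in [set l : R | (0 < l)%R]].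

Definition orlicz_ext (psi : R -> \bar R) (x : \bar R) : \bar R :=
  match x with
  | r%:E => psi r
  | +oo => +oo
  | -oo => psi 0%R
  end.

Context {d : measure_display} {T : measurableType d}.

Definition luxemburg (psi : R -> \bar R) (mu : set T -> \bar R) (U : T -> \bar R)
  : \bar R :=
  ereal_inf [set sigma%:E | sigma in
    [set sigma : R | (0 < sigma)%R /\
       \int[mu]_x orlicz_ext psi (`|U x| * (sigma^-1)%:E) <= 1]].

Definition amemiya (psi : R -> \bar R) (mu : set T -> \bar R) (U : T -> \bar R)
  : \bar R :=
  ereal_inf [set (\int[mu]_x orlicz_ext psi (t%:E * `|U x|) + 1) * (t^-1)%:E
             | t in [set t : R | (0 < t)%R]].

End orlicz.

(* Main.v *)
(** Since [L <= gamma + max (L - gamma) 0], it suffices to bound the integral of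
    [1_E * max (L - gamma) 0] against the product measure. By Tonelli this is an
    iterated integral, and Hölder's inequality between the Luxemburg norm of an
    Orlicz function and the Amemiya norm of its conjugate, itself an integrated
    form of Young's inequality [x * y <= psi x + psi^* y], applies to the inner
    and then to the outer integral. *)

Require Import Defs.
From HB Require Import structures.
From mathcomp Require Import all_boot all_order all_algebra.
From mathcomp Require Import all_classical all_reals all_analysis.
From mathcomp Require Import measurable_realfun.
From mathcomp Require Import lra.
Import Order.TTheory GRing.Theory Num.Theory.
Local Open Scope classical_set_scope.
Local Open Scope ring_scope.
Local Open Scope ereal_scope.

Set Implicit Arguments.
Unset Strict Implicit.

(** * Measurability of monotone functions on the extended reals *)

Lemma measurable_fun_lt_EFin (d : measure_display) (T : measurableType d)
    (R : realType) (f : T -> \bar R) :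
  (forall r : R, measurable [set x | f x < r%:E]) -> measurable_fun setT f.
Proof.
move=> mf; apply: (measurability _ (ErealGenInftyO.measurableE R)).
by move=> _ /= [_ [r ->] <-]; rewrite setTI preimage_itvNyo; exact: mf.
Qed.

(** Each strict sublevel set is downward closed, hence a ray ending at its supremum [m]: closed if
    [m] belongs to it, open otherwise. *)
Lemma nondecreasing_emeasurable (R : realType) (h : \bar R -> \bar R) :
  {homo h : x y / x <= y} -> measurable_fun setT h.
Proof.
move=> hh; apply: measurable_fun_lt_EFin => r.
set A := [set x | h x < r%:E]; set m := ereal_sup A.
have [Am|nAm] := pselect (A m).
  rewrite (_ : A = [set` `]-oo, m]%O]); first exact: emeasurable_itv.
  apply/seteqP; split => x /=; rewrite in_itv /=.
    by move=> Ax; exact: ereal_sup_ubound.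
  by move=> xm; exact: le_lt_trans (hh _ _ xm) Am.
rewrite (_ : A = [set` `]-oo, m[%O]); first exact: emeasurable_itv.
apply/seteqP; split => x /=; rewrite in_itv /=.
  move=> Ax; rewrite lt_neqAle (ereal_sup_ubound Ax) andbT.
  by apply: contra_notN nAm => /eqP <-.
by move=> /ereal_sup_gt[y Ay xy]; exact: le_lt_trans (hh _ _ (ltW xy)) Ay.
Qed.

(** * Orlicz functions, their conjugates and Young's inequality *)

Section gauge.
Context {R : realType}.
Implicit Types g psi : R -> \bar R.

(* The properties of an Orlicz function that its conjugate shares; the last one
   makes both Orlicz norms dominate the L1 norm. *)
Definition gauge g : Prop :=
  [/\ forall x : R, (0 <= x)%R -> 0 <= g x,
      forall x y : R, (0 <= x)%R -> (x <= y)%R -> g x <= g y &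
      exists2 K : R, (0 < K)%R &
        forall x : R, (0 <= x)%R -> x%:E <= K%:E * (g x + 1)].

Lemma orlicz_scale psi (x t : R) : is_orlicz psi -> (0 <= x)%R ->
  (0 <= t <= 1)%R -> psi (t * x)%R <= t%:E * psi x.
Proof.
move=> [psi0 _ cvx _ _] x0 t01.
have := cvx x 0%R t x0 (lexx _) t01.
by rewrite mulr0 addr0 psi0 mule0 adde0.
Qed.

(** Convexity and [psi 0 = 0] give [psi (t * x) <= t * psi x] for [t] in [0, 1]. Taking [t = x / y]
    yields monotonicity; taking [t = x0 / x] yields linear growth beyond a point [x0] where [psi] is
    positive. *)
Lemma orlicz_gauge psi : is_orlicz psi -> gauge psi.
Proof.
move=> opsi; have [psi0 psi_ge0 _ [x0 [x0_gt0 psix0]] _] := opsi.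
have mono (x y : R) : (0 <= x)%R -> (x <= y)%R -> psi x <= psi y.
  move=> x_ge0 xy; have [y0|y_le0] := ltP 0%R y; last first.
    by rewrite (_ : x = y)//; apply/le_anti; rewrite xy (le_trans y_le0).
  have t01 : (0 <= x / y <= 1)%R.
    by rewrite divr_ge0 ?(ltW y0)//= ler_pdivrMr// mul1r.
  have := orlicz_scale opsi (ltW y0) t01; rewrite divfK ?gt_eqF// => /le_trans.
  apply; rewrite -[leRHS]mul1e lee_wpmul2r ?psi_ge0 ?(ltW y0)// lee_fin.
  by case/andP: t01.
split => //.
have psix0_gt0 : 0 < psi x0 by rewrite lt_neqAle eq_sym psix0 psi_ge0 ?ltW.
(* Since [psi x0] may be [+oo], a positive real [c] below it replaces it. *)
have [c c0 cpsi] : exists2 c : R, (0 < c)%R & c%:E <= psi x0.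
  case: (psi x0) psix0_gt0 => [r| |]//; rewrite ?lte_fin => r0; first by exists r.
  by exists 1%R; rewrite ?leey.
have xc0 : (0 < x0 / c)%R by rewrite divr_gt0.
have K0 : (0 < x0 + x0 / c)%R by rewrite addr_gt0.
(* The summand [x0] handles [x <= x0]; beyond [x0], [psi x >= c * x / x0] and the summand [x0 / c]
   suffices. *)
exists (x0 + x0 / c)%R => // x x_ge0.
have := psi_ge0 _ x_ge0; case E : (psi x) => [r| |]//; last first.
  by rewrite addye// gt0_muley ?leey ?lte_fin.
rewrite -EFinD -EFinM !lee_fin => r0.
have [xx0|x0x] := leP x x0.
  by rewrite (le_trans xx0)// -[leLHS]mulr1 ler_pM ?(ltW x0_gt0)//; lra.
have t01 : (0 <= x0 / x <= 1)%R.
  by rewrite divr_ge0 ?ler_pdivrMr ?mul1r ?(lt_trans x0_gt0)//= ltW.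
have := le_trans cpsi (eq_ind _ (fun z => psi z <= _) (orlicz_scale opsi x_ge0 t01) _
  (divfK _ _)).
rewrite gt_eqF ?(lt_trans x0_gt0)// => /(_ isT).
rewrite E -EFinM lee_fin mulrAC ler_pdivlMr ?(lt_trans x0_gt0)// => cx.
have : (x <= x0 / c * r)%R by rewrite mulrAC ler_pdivlMr// mulrC.
by move=> /le_trans; apply; rewrite ler_pM ?(ltW xc0)//; lra.
Qed.

(** Everything comes from single terms of the supremum: points near 0, where [psi] is small, give
    nonnegativity, and a point [x0] with [psi x0] finite gives linear growth. *)
Lemma orlicz_conj_gauge psi : is_orlicz psi -> gauge (orlicz_conj psi).
Proof.
move=> opsi; have [psi0 psi_ge0 _ _ [x0 [x0_gt0 psix0]]] := opsi.
have psix0_fin : psi x0 \is a fin_num.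
  by rewrite ge0_fin_numE ?ltey// psi_ge0 ?ltW.
have ge_conj (t l : R) : (0 < l)%R -> (l * t)%:E - psi l <= orlicz_conj psi t.
  by move=> l0; apply: ereal_sup_ubound; exists l.
have conj_ge0 (t : R) : (0 <= t)%R -> 0 <= orlicz_conj psi t.
  move=> t0; apply/lee_addgt0Pr => e e0.
  have psi_fine0 : (0 <= fine (psi x0))%R by rewrite fine_ge0// psi_ge0 ?ltW.
  (* This scale gives [psi (s * x0) <= s * psi x0 <= e], and the denominator is positive even if
     [psi x0 = 0]. *)
  set s := (e / (e + fine (psi x0)))%R.
  have s0 : (0 < s)%R by rewrite divr_gt0// ltr_pwDl.
  have s1 : (s <= 1)%R by rewrite ler_pdivrMr ?ltr_pwDl// mul1r lerDl.
  have sx0 : (0 < s * x0)%R by rewrite mulr_gt0.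
  have : psi (s * x0)%R <= e%:E.
    rewrite (le_trans (orlicz_scale opsi _ _))// ?(ltW x0_gt0) ?s1 ?(ltW s0)//.
    rewrite -(fineK psix0_fin) -EFinM lee_fin /s mulrAC ler_pdivrMr ?ltr_pwDl//.
    by rewrite ler_pM2l// lerDr ltW.
  move=> psie; rewrite -leeBlDr// sub0e (le_trans _ (ge_conj t _ sx0))//.
  rewrite -[leLHS]add0e leeD ?lee_fin ?leeN2// mulr_ge0// ltW//.
split=> // [x y x_ge0 xy|].
  apply: ge_ereal_sup => _ [l l0 <-]; apply: le_trans (ge_conj y l l0).
  by rewrite leeD2r// lee_fin ler_wpM2l// ltW.
(* The term [l = x0] gives [x0 * x <= r + psi x0], where [r] is the conjugate at [x]; this is at
   most [(1 + psi x0) * (r + 1)]. *)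
pose K := ((1 + fine (psi x0)) / x0)%R.
have f0 : (0 <= fine (psi x0))%R by rewrite fine_ge0// psi_ge0 ?ltW.
have K0 : (0 < K)%R by rewrite divr_gt0// ltr_pwDl.
exists K => // x x_ge0.
have := ge_conj x _ x0_gt0; have := conj_ge0 x x_ge0.
case: (orlicz_conj psi x) => [r| |]//; last first.
  by rewrite addye// gt0_muley ?leey ?lte_fin.
rewrite -(fineK psix0_fin) -EFinB -EFinD -EFinM !lee_fin => r0 xr.
by rewrite /K mulrAC ler_pdivlMr//; nra.
Qed.

Lemma le_orlicz_ext g (x y : \bar R) : gauge g -> 0 <= x -> x <= y ->
  orlicz_ext g x <= orlicz_ext g y.
Proof.
move=> [_ mono _]; case: x y => [x| |] [y| |]//=; rewrite ?leey// !lee_fin.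
exact: mono.
Qed.

Lemma orlicz_ext_ge0 g (x : \bar R) : gauge g -> 0 <= x -> 0 <= orlicz_ext g x.
Proof. by move=> [g0 _ _]; case: x => [x| |]//=; rewrite lee_fin; exact: g0. Qed.

Lemma gauge_ext g : gauge g -> exists2 K : R, (0 < K)%R &
  forall x : \bar R, 0 <= x -> x <= K%:E * (orlicz_ext g x + 1).
Proof.
move=> [_ _ [K K0 gK]]; exists K => // -[x| |]//=; first by rewrite lee_fin; exact: gK.
by rewrite addye// gt0_muley ?lte_fin.
Qed.

(** For finite [x > 0] this is one term of the supremum defining the conjugate. That supremum omits
    0, so [x = 0] is settled by nonnegativity; infinite values make the right-hand side [+oo]. *)
Lemma orlicz_young psi (x y : \bar R) : is_orlicz psi -> 0 <= x -> 0 <= y ->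
  x * y <= orlicz_ext psi x + orlicz_ext (orlicz_conj psi) y.
Proof.
move=> opsi; have gpsi := orlicz_gauge opsi; have gconj := orlicz_conj_gauge opsi.
have [->|xNy] := eqVneq x +oo.
  by move=> _ y0; rewrite /= addye ?leey// gt_eqF// (lt_le_trans _ (orlicz_ext_ge0 gconj y0)).
have [->|yNy] := eqVneq y +oo.
  by move=> x0 _; rewrite /= addey ?leey// gt_eqF// (lt_le_trans _ (orlicz_ext_ge0 gpsi x0)).
case: x y xNy yNy => [x| |] [y| |]// _ _; rewrite !lee_fin => x0 y0 /=.
have [x_gt0|] := ltP 0%R x; last first.
  move=> x_le0; rewrite (_ : x = 0%R); last by apply/le_anti; rewrite x_le0.
  by rewrite mul0e adde_ge0//; [exact: (orlicz_ext_ge0 gpsi (x := 0))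
    |exact: (orlicz_ext_ge0 gconj (x := y%:E))].
have : (x * y)%:E - psi x <= orlicz_conj psi y.
  by apply: ereal_sup_ubound; exists x.
have := orlicz_ext_ge0 gpsi (x := x%:E) x0; rewrite /=.
have := orlicz_ext_ge0 gconj (x := y%:E) y0; rewrite /=.
case: (psi x) => [r| |]//; last by move=> c0; rewrite addye ?leey// gt_eqF// (lt_le_trans _ c0).
by move=> _ _; rewrite leeBlDr// addeC.
Qed.

Lemma measurable_orlicz_ext (d : measure_display) (T : measurableType d) g
    (f : T -> \bar R) : gauge g -> measurable_fun setT f ->
  (forall x, 0 <= f x) -> measurable_fun setT (fun x => orlicz_ext g (f x)).
Proof.
move=> gg mf f0.
(* A gauge is controlled only on nonnegative arguments; truncating at 0 makes it nondecreasing on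
   the whole extended line. *)
rewrite (_ : (fun _ => _) = (fun y => orlicz_ext g (maxe 0 y)) \o f); last first.
  by apply/funext => x /=; rewrite max_r.
apply: measurableT_comp mf; apply: nondecreasing_emeasurable => x y xy.
by apply: le_orlicz_ext => //; rewrite ?ge_max !le_max !lexx ?xy ?orbT.
Qed.

End gauge.

(** * Luxemburg and Amemiya norms and Hölder's inequality *)

Section orlicz_norms.
Context {R : realType}.
Implicit Types (g psi : R -> \bar R).

Lemma luxemburg_ge0 (d : measure_display) (T : measurableType d) g
    (mu : set T -> \bar R) (U : T -> \bar R) : 0 <= luxemburg g mu U.
Proof. by apply: le_ereal_inf_tmp => _ [s [s0 _] <-]; rewrite lee_fin ltW. Qed.

(** The infimum over [B] is taken first with [a] fixed, then the one over [A]. Positivity of both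
    infima rules out the product of 0 and [+oo], which may occur when a set is empty. *)
Lemma le_mul_ereal_inf (A : set R) (B : set \bar R) (c : \bar R) :
  (forall a b, A a -> B b -> (0 < a)%R /\ c <= a%:E * b) ->
  0 < ereal_inf [set a%:E | a in A] -> 0 < ereal_inf B ->
  c <= ereal_inf [set a%:E | a in A] * ereal_inf B.
Proof.
move=> cAB A0 B0.
have cA a : A a -> c <= a%:E * ereal_inf B.
  move=> Aa; have [->|/set0P[b Bb]] := eqVneq B set0.
    have [a0|a0] := ltP 0%R a; first by rewrite ereal_inf0 gt0_muley ?leey.
    have := ereal_inf_lbound (imageP EFin Aa).
    by move=> /(lt_le_trans A0); rewrite lte_fin ltNge a0.
  have [a0 _] := cAB _ _ Aa Bb.
  rewrite -ereal_inf_pZl//; apply: le_ereal_inf_tmp => _ [b' Bb' <-].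
  by have [] := cAB _ _ Aa Bb'.
case: (ereal_inf B) B0 cA => [r| |]//.
  rewrite lte_fin => r0 cA; rewrite muleC -ereal_inf_pZl//.
  by apply: le_ereal_inf_tmp => _ [_ [a Aa <-] <-]; rewrite muleC; exact: cA.
by move=> _ _; rewrite gt0_muley ?leey.
Qed.

Context {d : measure_display} {T : measurableType d}.
Variable mu : {measure set T -> \bar R}.
Implicit Types U V : T -> \bar R.

Lemma amemiya_ge0 g U : gauge g -> 0 <= amemiya g mu U.
Proof.
move=> gg; apply: le_ereal_inf_tmp => _ [t /= t0 <-].
rewrite mule_ge0// ?lee_fin ?invr_ge0 ?(ltW t0)// adde_ge0// integral_ge0// => x _.
by rewrite orlicz_ext_ge0// mule_ge0 ?lee_fin ?(ltW t0).
Qed.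

Lemma measurable_orlicz_extZ g U (k : R) : gauge g -> measurable_fun setT U ->
  (0 <= k)%R -> (forall x, 0 <= U x) ->
  measurable_fun setT (fun x => orlicz_ext g (k%:E * U x)).
Proof.
move=> gg mU k0 U0; apply: measurable_orlicz_ext => //; first exact: measurable_funeM.
by move=> x; rewrite mule_ge0.
Qed.

Lemma luxemburgE g U : (forall x, 0 <= U x) -> luxemburg g mu U =
  ereal_inf [set sigma%:E | sigma in [set sigma : R | (0 < sigma)%R /\
    \int[mu]_x orlicz_ext g ((sigma^-1)%:E * U x) <= 1]].
Proof.
move=> U0; rewrite /luxemburg; congr (ereal_inf (_ @` _)); apply/seteqP.
have E (s : R) : \int[mu]_x orlicz_ext g (`|U x| * (s^-1)%:E) =
    \int[mu]_x orlicz_ext g ((s^-1)%:E * U x).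
  by apply: eq_integral => x _; rewrite gee0_abs// muleC.
by split => s /=; rewrite E.
Qed.

Lemma amemiyaE g U : (forall x, 0 <= U x) -> amemiya g mu U =
  ereal_inf [set (\int[mu]_x orlicz_ext g (t%:E * U x) + 1) * (t^-1)%:E
             | t in [set t : R | (0 < t)%R]].
Proof.
move=> U0; rewrite /amemiya; congr (ereal_inf (_ @` _)); apply/funext => t.
by under eq_integral => x _ do rewrite gee0_abs//.
Qed.

Hypothesis mu1 : mu setT <= 1.

(** Integrating the linear growth bound at [t * U]; total mass at most 1 bounds the integral of the
    constant 1. The constant [K] depends on [g] alone, so infima over [t] may follow. *)
Lemma integral_le_gauge g : gauge g -> exists2 K : R, (0 < K)%R &
  forall U (t : R), measurable_fun setT U -> (forall x, 0 <= U x) -> (0 < t)%R ->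
  \int[mu]_x U x <=
    K%:E * ((\int[mu]_x orlicz_ext g (t%:E * U x) + 1) * (t^-1)%:E).
Proof.
move=> gg; have [K K0 gK] := gauge_ext gg; exists K => // U t mU U0 t0.
have mg : measurable_fun setT (fun x => orlicz_ext g (t%:E * U x)).
  by apply: measurable_orlicz_extZ => //; exact: ltW.
have g0 x : 0 <= orlicz_ext g (t%:E * U x).
  by rewrite orlicz_ext_ge0// mule_ge0 ?lee_fin ?(ltW t0).
rewrite muleA lee_pdivlMr// muleC -ge0_integralZl_EFin ?(ltW t0)//.
have /le_trans : \int[mu]_x (t%:E * U x) <=
    \int[mu]_x (K%:E * (orlicz_ext g (t%:E * U x) + 1)).
  apply: ge0_le_integral => //.
  - by move=> x _; rewrite mule_ge0 ?lee_fin ?(ltW t0).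
  - exact: measurable_funeM.
  - by apply: measurable_funeM; apply: emeasurable_funD.
  - by move=> x _; apply: gK; rewrite mule_ge0 ?lee_fin ?(ltW t0).
apply; rewrite ge0_integralZl_EFin ?(ltW K0)//; last 2 first.
- by move=> x _; rewrite adde_ge0.
- exact: emeasurable_funD.
rewrite lee_wpmul2l ?lee_fin ?(ltW K0)// ge0_integralD//.
by rewrite leeD2l// integral_cst// mul1e.
Qed.

Lemma luxemburg_eq0 g U : gauge g -> measurable_fun setT U ->
  (forall x, 0 <= U x) -> luxemburg g mu U = 0 -> \int[mu]_x U x = 0.
Proof.
move=> gg mU U0 lux0; have [K K0 UK] := integral_le_gauge gg.
apply/eqP; rewrite eq_le integral_ge0// andbT.
(* The factor 2 arises because an admissible [s] has modular at most 1, so at [t = s^-1] the modular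
   plus 1 is at most 2. *)
have : \int[mu]_x U x <= (K * 2)%:E * luxemburg g mu U.
  rewrite luxemburgE// -ereal_inf_pZl ?mulr_gt0//.
  apply: le_ereal_inf_tmp => _ [_ [s [s0 int_le1] <-] <-].
  have := UK U s^-1%R mU U0; rewrite invr_gt0 => /(_ s0) /le_trans; apply.
  rewrite EFinM -muleA lee_wpmul2l ?lee_fin ?(ltW K0)// invrK.
  by rewrite lee_wpmul2r ?lee_fin ?(ltW s0)// -[2%:E]/((1 + 1)%:E) EFinD leeD2r.
by rewrite lux0 mule0.
Qed.

Lemma amemiya_eq0 g U : gauge g -> measurable_fun setT U ->
  (forall x, 0 <= U x) -> amemiya g mu U = 0 -> \int[mu]_x U x = 0.
Proof.
move=> gg mU U0 am0; have [K K0 UK] := integral_le_gauge gg.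
apply/eqP; rewrite eq_le integral_ge0// andbT.
have : \int[mu]_x U x <= K%:E * amemiya g mu U.
  rewrite amemiyaE// -ereal_inf_pZl//.
  by apply: le_ereal_inf_tmp => _ [_ [t t0 <-] <-]; exact: UK.
by rewrite am0 mule0.
Qed.

Lemma integralM_eq0 U V : measurable_fun setT U -> measurable_fun setT V ->
  (forall x, 0 <= U x) -> (forall x, 0 <= V x) -> \int[mu]_x U x = 0 ->
  \int[mu]_x (U x * V x) = 0.
Proof.
move=> mU mV U0 V0 int0.
have U_ae0 : ae_eq mu setT U (cst 0).
  apply/ae_eq_integral_abs => //.
  by under eq_integral do rewrite gee0_abs//.
rewrite (@ge0_ae_eq_integral _ _ _ mu setT _ (cst 0))//; first exact: integral0.
- exact: emeasurable_funM.
- by move=> x _; rewrite mule_ge0.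
- by apply: filterS U_ae0 => x /= /[apply] ->; rewrite mul0e.
Qed.

Lemma orlicz_hoelder psi U V : is_orlicz psi ->
  measurable_fun setT U -> measurable_fun setT V ->
  (forall x, 0 <= U x) -> (forall x, 0 <= V x) ->
  \int[mu]_x (U x * V x) <= luxemburg psi mu U * amemiya (orlicz_conj psi) mu V.
Proof.
move=> opsi mU mV U0 V0.
have gpsi := orlicz_gauge opsi; have gconj := orlicz_conj_gauge opsi.
(* As [0 * +oo = 0], a vanishing norm must be treated separately: it forces the
   function to vanish almost everywhere. *)
have [lux0|luxN0] := eqVneq (luxemburg psi mu U) 0.
  by rewrite lux0 mul0e integralM_eq0//; exact: luxemburg_eq0 lux0.
have [am0|amN0] := eqVneq (amemiya (orlicz_conj psi) mu V) 0.
  rewrite am0 mule0; under eq_integral do rewrite muleC.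
  by rewrite integralM_eq0//; exact: amemiya_eq0 am0.
have lux_gt0 : 0 < luxemburg psi mu U by rewrite lt_neqAle eq_sym luxN0 luxemburg_ge0.
have am_gt0 : 0 < amemiya (orlicz_conj psi) mu V.
  by rewrite lt_neqAle eq_sym amN0 amemiya_ge0.
rewrite luxemburgE// in lux_gt0 *; rewrite amemiyaE// in am_gt0 *.
apply: le_mul_ereal_inf => // s _ [s0 int_le1] [t /= t0 <-]; split => //.
have [s_ge0 t_ge0] := (ltW s0, ltW t0).
have sV0 : (0 <= s^-1)%R by rewrite invr_ge0.
(* Multiplying by [t / s] reduces the goal to bounding the integral of [(U / s) * (t * V)], to which
   Young's inequality applies pointwise; admissibility of [s] then bounds the [psi] part by 1. *)
rewrite muleA lee_pdivlMr// muleC -lee_pdivrMl// muleA -EFinM.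
rewrite -ge0_integralZl_EFin ?divr_ge0 ?mulr_ge0//; last 2 first.
- by move=> x _; rewrite mule_ge0.
- exact: emeasurable_funM.
have mg : measurable_fun setT (fun x => orlicz_ext psi ((s^-1)%:E * U x)).
  exact: measurable_orlicz_extZ.
have mh : measurable_fun setT (fun x => orlicz_ext (orlicz_conj psi) (t%:E * V x)).
  exact: measurable_orlicz_extZ.
have g0 x : 0 <= orlicz_ext psi ((s^-1)%:E * U x).
  by rewrite orlicz_ext_ge0// mule_ge0.
have h0 x : 0 <= orlicz_ext (orlicz_conj psi) (t%:E * V x).
  by rewrite orlicz_ext_ge0// mule_ge0.
apply: (@le_trans _ _ (\int[mu]_x (orlicz_ext psi ((s^-1)%:E * U x) +
    orlicz_ext (orlicz_conj psi) (t%:E * V x)))).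
  apply: ge0_le_integral => //.
  - by move=> x _; rewrite !mule_ge0 ?lee_fin ?mulr_ge0.
  - by apply: measurable_funeM; exact: emeasurable_funM.
  - exact: emeasurable_funD.
  - move=> x _; rewrite EFinM muleACA.
    by apply: orlicz_young => //; rewrite mule_ge0.
by rewrite ge0_integralD// addeC leeD2l.
Qed.

End orlicz_norms.

(** * Measurability of the norms of sections *)

Section measurability_of_sections.
Context {R : realType} {d : measure_display} {W : measurableType d}.

(** The second premise makes the set where the infimum is below [c] a countable union over positive
    rationals. *)
Lemma measurable_ereal_inf_rat (G : R -> W -> \bar R) :
  (forall t, (0 < t)%R -> measurable_fun setT (G t)) ->
  (forall w t (c : R), (0 < t)%R -> G t w < c%:E ->
    exists q : rat, (0 < ratr q :> R)%R /\ G (ratr q) w < c%:E) ->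
  measurable_fun setT (fun w => ereal_inf [set G t w | t in [set t : R | (0 < t)%R]]).
Proof.
move=> mG Grat; apply: measurable_fun_lt_EFin => c.
rewrite (_ : [set _ | _] = \bigcup_(q : rat) [set w | (0 < ratr q :> R)%R /\
    G (ratr q) w < c%:E]).
  apply: bigcupT_measurable_rat => q.
  have [q0|q0] := ltP 0%R (ratr q : R); last first.
    by rewrite (_ : [set _ | _] = set0)//; apply/seteqP; split => w // -[].
  rewrite (_ : [set _ | _] = setT `&` [set w | G (ratr q) w < c%:E]); last first.
    by apply/seteqP; split => w [].
  by apply: emeasurable_fun_infty_o => //; exact: mG.
apply/seteqP; split => w /=.
  by move=> /ereal_inf_lt[_ [t t0 <-] /Grat[]// q qP]; exists q.
by move=> [q _ [q0 Gq]]; apply: le_lt_trans Gq; apply: ereal_inf_lbound; exists (ratr q).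
Qed.

Context {d' : measure_display} {S : measurableType d'}.
Variables (mu : {sigma_finite_measure set S -> \bar R}) (g : R -> \bar R).
Hypothesis gg : gauge g.
Variable U : S * W -> \bar R.
Hypotheses (mU : measurable_fun setT U) (U0 : forall z, 0 <= U z).

(** The modular shared by both norms: the Luxemburg constraint uses it at [t^-1], the Amemiya
    quotient at [t]. *)
Let I (t : R) (w : W) := \int[mu]_s orlicz_ext g (t%:E * U (s, w)).

Let measurable_I (t : R) : (0 < t)%R -> measurable_fun setT (I t).
Proof.
move=> t0; apply: (@measurable_fun_fubini_tonelli_G _ _ _ _ _ mu
  (fun z => orlicz_ext g (t%:E * U z))).
  by apply: measurable_orlicz_extZ => //; exact: ltW.
by move=> z; rewrite orlicz_ext_ge0// mule_ge0// lee_fin ltW.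
Qed.

Let le_I (t u : R) w : (0 < t)%R -> (t <= u)%R -> I t w <= I u w.
Proof.
move=> t0 tu; have u0 := lt_le_trans t0 tu.
have mUw : measurable_fun setT (fun s => U (s, w)).
  exact: (measurableT_comp mU (pair2_measurable w)).
apply: ge0_le_integral => //.
- by move=> s _; rewrite orlicz_ext_ge0// mule_ge0// lee_fin ltW.
- by apply: measurable_orlicz_extZ => //; exact: ltW.
- by apply: measurable_orlicz_extZ => //; exact: ltW.
- move=> s _; apply: le_orlicz_ext => //; first by rewrite mule_ge0// lee_fin ltW.
  by rewrite lee_wpmul2r.
Qed.

Lemma measurable_luxemburg :
  measurable_fun setT (fun w => luxemburg g mu (fun s => U (s, w))).
Proof.
(* The admissible set depends on [w]; giving inadmissible [t] the value [+oo] turns the norm into an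
   infimum over a fixed index set. *)
pose G (t : R) w := if I t^-1 w <= 1 then t%:E else +oo.
rewrite (_ : (fun _ => _) =
    (fun w => ereal_inf [set G t w | t in [set t : R | (0 < t)%R]])); last first.
  apply/funext => w; rewrite luxemburgE//; apply/le_anti/andP; split.
    apply: le_ereal_inf_tmp => _ [t t0 <-]; rewrite /G; case: ifPn; rewrite ?leey// => It.
    by apply: ereal_inf_lbound; exists t.
  apply: le_ereal_inf_tmp => _ [t [t0 It] <-]; apply: ereal_inf_lbound.
  by exists t => //; rewrite /G ifT.
apply: measurable_ereal_inf_rat => [t t0|w t c t0].
  apply: measurable_fun_ifT => //.
  by apply: measurable_fun_lee => //; apply: measurable_I; rewrite invr_gt0.
(* A rational between [t] and [c] stays admissible, since the modular at [q^-1] is at most the one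
   at [t^-1]. *)
rewrite /G; case: ifPn => // It; rewrite lte_fin => /rat_in_itvoo[q].
rewrite in_itv /= => /andP[tq qc]; have q0 := lt_trans t0 tq.
exists q; split => //; rewrite ifT ?lte_fin// (le_trans _ It)// le_I ?invr_gt0//.
by rewrite lef_pV2 ?posrE// ltW.
Qed.

Lemma measurable_amemiya :
  measurable_fun setT (fun w => amemiya g mu (fun s => U (s, w))).
Proof.
pose G (t : R) w := (I t w + 1) * (t^-1)%:E.
rewrite (_ : (fun _ => _) =
    (fun w => ereal_inf [set G t w | t in [set t : R | (0 < t)%R]])); last first.
  by apply/funext => w; rewrite amemiyaE.
apply: measurable_ereal_inf_rat => [t t0|w t c t0].
  rewrite /G; under eq_fun do rewrite muleC.
  by apply: measurable_funeM; apply: emeasurable_funD => //; exact: measurable_I.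
rewrite /G lte_pdivrMr// => Gc.
have I0 : 0 <= I t w.
  by apply: integral_ge0 => s _; rewrite orlicz_ext_ge0// mule_ge0// lee_fin ltW.
case E : (I t w) I0 Gc => [r| |]//; rewrite lee_fin -EFinD -EFinM lte_fin => r0 rct.
(* [I] is nondecreasing in [t], so decreasing [t] to a rational [q] multiplies
   [G t w] by at most [t / q]. *)
have c0 : (0 < c)%R by nra.
(* The lower end is chosen so that [q > (r + 1) / c] means [(r + 1) / q < c]. *)
have /rat_in_itvoo[q] : ((r + 1) / c < t)%R by rewrite ltr_pdivrMr// mulrC.
rewrite in_itv /= => /andP[rq qt].
have q0 : (0 < ratr q :> R)%R by apply: le_lt_trans rq; rewrite divr_ge0 ?addr_ge0// ltW.
exists q; split => //; rewrite lte_pdivrMr//.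
apply: le_lt_trans (_ : I t w + 1 < _); first by rewrite leeD2r// le_I// ltW.
by rewrite E -EFinD -EFinM lte_fin mulrC -ltr_pdivrMr.
Qed.

End measurability_of_sections.

(** * Hölder's inequality for iterated norms *)

Lemma expected_hoelder (d1 d2 : measure_display) (S : measurableType d1)
    (W : measurableType d2) (R : realType) (mu : probability S R)
    (nu : probability W R) (psi phi : R -> \bar R) (U V : S * W -> \bar R) :
  is_orlicz psi -> is_orlicz phi ->
  measurable_fun setT U -> measurable_fun setT V ->
  (forall z, 0 <= U z) -> (forall z, 0 <= V z) ->
  \int[mu \x nu]_z (U z * V z) <=
    luxemburg psi nu (fun w => luxemburg phi mu (fun s => U (s, w))) *
    amemiya (orlicz_conj psi) nu
      (fun w => amemiya (orlicz_conj phi) mu (fun s => V (s, w))).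
Proof.
move=> opsi ophi mU mV U0 V0.
have gphi := orlicz_gauge ophi; have gconj := orlicz_conj_gauge ophi.
have mUV : measurable_fun setT (fun z => U z * V z) by exact: emeasurable_funM.
have UV0 z : 0 <= U z * V z by rewrite mule_ge0.
have mN := measurable_luxemburg mu gphi mU U0.
have mA := measurable_amemiya mu gconj mV V0.
rewrite fubini_tonelli2//.
have leT1 (d : measure_display) (T : measurableType d) (p : probability T R) :
  p setT <= 1 by rewrite probability_setT.
have N0 w : 0 <= luxemburg phi mu (fun s => U (s, w)) by exact: luxemburg_ge0.
have A0 w : 0 <= amemiya (orlicz_conj phi) mu (fun s => V (s, w)).
  exact: amemiya_ge0.
(* The outer inequality is applied to the norms of sections as functions of [w]; what remains is the
   inner inequality for each [w]. *)
apply: le_trans (orlicz_hoelder (leT1 _ _ nu) opsi mN mA N0 A0).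
apply: ge0_le_integral => //.
- by move=> w _; apply: integral_ge0.
- exact: measurable_fun_fubini_tonelli_G.
- exact: emeasurable_funM.
- move=> w _; apply: orlicz_hoelder => //; first exact: leT1.
  + exact: (measurableT_comp mU (pair2_measurable w)).
  + exact: (measurableT_comp mV (pair2_measurable w)).
Qed.

(** * Splitting the density at the threshold and conclusion *)

Lemma integral_le_threshold (d : measure_display) (T : measurableType d)
    (R : realType) (mu : {measure set T -> \bar R}) (E : set T) (L : T -> R)
    (gamma : R) : mu E < +oo -> measurable E -> measurable_fun setT L ->
  (forall z, (0 <= L z)%R) ->
  \int[mu]_(z in E) (L z)%:E <=
    gamma%:E * mu E + \int[mu]_z ((\1_E z)%:E * (Num.max (L z - gamma) 0)%:E).
Proof.
move=> muE mE mL L0; pose M z := (Num.max (L z - gamma) 0)%:E : \bar R.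
have M0 z : 0 <= M z by rewrite lee_fin le_max lexx orbT.
have mLE : measurable_fun E (fun z => (L z)%:E).
  by apply/measurable_EFinP; exact: measurable_funTS.
have mM : measurable_fun E M.
  apply/measurable_EFinP; apply: measurable_funTS.
  by apply: measurable_maxr => //; exact: measurable_funB.
have -> : \int[mu]_z ((\1_E z)%:E * (Num.max (L z - gamma) 0)%:E) =
    \int[mu]_(z in E) M z.
  rewrite [RHS]integral_mkcond; apply: eq_integral => z _.
  by rewrite patchE indicE; case: ifP => _; rewrite ?mul1e ?mul0e.
have [gamma0|gamma0] := leP 0%R gamma.
  rewrite -integral_cst// -ge0_integralD//.
  apply: ge0_le_integral => //; first by move=> z _; rewrite lee_fin.
    by apply: emeasurable_funD.
  by move=> z _; rewrite /M /= -EFinD lee_fin -lerBlDl le_max lexx.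
(* For negative [gamma] the term moves to the left-hand side, where finiteness of [mu E] permits the
   subtraction and all integrands are again nonnegative. *)
have fin : gamma%:E * mu E \is a fin_num by rewrite fin_numM// ge0_fin_numE.
rewrite -leeBlDl// -mulNe -EFinN -integral_cst// -ge0_integralD//; last 2 first.
- by move=> z _; rewrite lee_fin.
- by move=> z _; rewrite lee_fin oppr_ge0 ltW.
apply: ge0_le_integral => //.
- by move=> z _; rewrite -EFinD lee_fin addr_ge0// oppr_ge0 ltW.
- exact: emeasurable_funD.
- by move=> z _; rewrite /M -EFinD lee_fin le_max lexx.
Qed.

Unset Implicit Arguments.

Theorem theorem3 (d1 d2 : measure_display)
  (S : measurableType d1) (W : measurableType d2) (R : realType)
  (P : probability (S * W)%type R) (L : S * W -> R)
  (psi phi : R -> \bar R) (E : set (S * W)) (gamma : R) :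
  let PS := pushforward P fst in
  let PW := pushforward P snd in
  P `<< (PS \x PW) ->
  measurable_fun setT L ->
  (forall z, (0 <= L z)%R) ->
  (forall A, measurable A -> P A = \int[PS \x PW]_(z in A) (L z)%:E) ->
  measurable E ->
  is_orlicz psi -> is_orlicz phi ->
  P E <= gamma%:E * (PS \x PW) E
         + luxemburg psi PW
             (fun w => luxemburg phi PS
                (fun s => (\1_[set s' | E (s', w)] s)%:E))
           * amemiya (orlicz_conj psi) PW
             (fun w => amemiya (orlicz_conj phi) PS
                (fun s => (Num.max (L (s, w) - gamma) 0)%:E)).
Proof.
move=> PS PW _ mL L0 PL mE opsi ophi.
(* The marginals [PS] and [PW] are bare set functions; [mu] and [nu] are the same functions carrying
   their probability structure. *)
pose mu : probability S R := distribution P (mfun_Sub (mem_set measurable_fst)).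
pose nu : probability W R := distribution P (mfun_Sub (mem_set measurable_snd)).
rewrite PL//.
apply: (le_trans (@integral_le_threshold _ _ _ (mu \x nu)%E E L gamma _ mE mL L0)).
  by rewrite (le_lt_trans (probability_le1 _ mE))// ltry.
apply: leeD2l.
apply: (@expected_hoelder _ _ _ _ _ mu nu psi phi (EFin \o \1_E)
  (fun z => (Num.max (L z - gamma) 0)%:E) opsi ophi).
- by apply/measurable_EFinP; exact: measurable_indic.
- apply/measurable_EFinP; apply: measurable_maxr => //.
  exact: measurable_funB.
- by move=> z; rewrite lee_fin indicE.
- by move=> z; rewrite lee_fin le_max lexx orbT.
Qed.
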